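(* Let $p\in(1,\infty)$, $q\in[p,\infty)$, $s\in\mathbb{Z}_+$, $\alpha=0$ and let $Q_0\subsetneqq\mathbb{R}^n$ be a closed cube. Then $$|Q_0|^{-\frac1p}\,JN_{(p,q,s)_\alpha}(Q_0)=L^q(Q_0,|Q_0|^{-1}dx)/\mathcal{P}_s(Q_0)$$ with equivalent norms.
   Context: $\mathbb{Z}_+$ is the set of non-negative integers. Cubes in $\mathbb{R}^n$ have edges parallel to the coordinate axes and finite positive edge length. For a cube $Q$ and an integrable $f$, $\frac{1}{|Q|}\int_Q f$ is also written $⨍_Q f$. For $s\in\mathbb{Z}_+$, $\mathcal{P}_s(Q)$ is the set of polynomials of degree not greater than $s$ on $Q$, and $P_Q^{(s)}(f)$ denotes the unique polynomial of degree not greater than $s$ such that $\int_Q[f(x)-P_Q^{(s)}(f)(x)]x^\gamma\,dx=0$ for all multi-indices $\gamma\in\mathbb{Z}_+^n$ with $|\gamma|\le s$. John--Nirenberg--Campanato space: for $p\in(1,\infty)$, $q\in[1,\infty)$, $s\in\mathbb{Z}_+$, $\alpha\in[0,\infty)$, $JN_{(p,q,s)_\alpha}(Q_0)$ is the set of all $f\in L^1_{\mathrm{loc}}(Q_0)$ with $$\|f\|_{JN_{(p,q,s)_\alpha}(Q_0)}:=\sup\left\{\sum_i|Q_i|\left[|Q_i|^{-\alpha}\left(\frac1{|Q_i|}\int_{Q_i}|f-P_{Q_i}^{(s)}(f)|^q\right)^{1/q}\right]^p\right\}^{1/p}<\infty,$$ where the supremum is over all collections of pairwise disjoint cubes $\{Q_i\}_i$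 in $Q_0$. ($L^1_{\mathrm{loc}}(Q_0)$: measurable $f$ with $f\mathbf 1_E\in L^1(Q_0)$ for every bounded $E\subset Q_0$; since $Q_0$ is bounded it equals $L^1(Q_0)$.) $\|f\|_{L^q(Q_0,|Q_0|^{-1}dx)}:=\left[\frac1{|Q_0|}\int_{Q_0}|f|^q\right]^{1/q}$, and $L^q(Q_0,|Q_0|^{-1}dx)/\mathcal{P}_s(Q_0)$ is the set of $f\in L^q(Q_0)$ with $\|f\|_{L^q(Q_0,|Q_0|^{-1}dx)/\mathcal{P}_s(Q_0)}:=\inf_{m\in\mathcal{P}_s(Q_0)}\|f+m\|_{L^q(Q_0,|Q_0|^{-1}dx)}<\infty$. For a constant $A>0$ and a function space $(\mathbb{X},\|\cdot\|_{\mathbb{X}})$, $A\mathbb{X}:=\{Af: f\in\mathbb{X}\}$; as a set of functions this is $\mathbb{X}$, and it is equipped with $\|f\|_{A\mathbb{X}}:=A\|f\|_{\mathbb{X}}$. All ''norms'' here that vanish on polynomials are understood as seminorms (equivalently, norms modulo polynomials of degree $\le s$). *)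

(* Defs.v *)
From HB Require Import structures.
From mathcomp Require Import all_boot all_order all_algebra.
From mathcomp Require Import all_classical all_reals all_analysis.
From mathcomp Require mpoly.
(* The notations of mpoly are incompatible with those of MathComp-Analysis. *)
Import (canonicals, coercions) mpoly.

Set Implicit Arguments.
Unset Strict Implicit.
Unset Printing Implicit Defensive.
Import Order.TTheory GRing.Theory Num.Theory.
Import numFieldNormedType.Exports.
Local Open Scope classical_set_scope.
Local Open Scope ring_scope.

(* Lebesgue measure on R^n: the n-fold product of the one-dimensional Lebesgue
   measure on the Borel sets of R^n is built by induction on n, and is then
   completed by Caratheodory's construction, so that [measurable] on [Rn R n]
   means Lebesgue measurable. *)

Section borel_lebesgue.
Local Open Scope ereal_scope.
Context (R : realType).

Definition borelRn (n : nat) : measurableType _ :=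
  n.-tuple (measurableTypeR R).

Definition pcons n (z : measurableTypeR R * borelRn n) : borelRn n.+1 :=
  [the n.+1.-tuple _ of z.1 :: z.2].

Definition puncons n (x : borelRn n.+1) : measurableTypeR R * borelRn n :=
  (thead x, [tuple of behead x]).

Lemma measurable_pcons n : measurable_fun [set: _] (@pcons n).
Proof. exact: measurable_cons. Qed.

Lemma measurable_puncons n : measurable_fun [set: _] (@puncons n).
Proof.
apply: measurable_fun_pair; last exact: measurable_behead.
exact: measurable_tnth.
Qed.

Lemma pconsK n : cancel (@pcons n) (@puncons n).
Proof.
move=> [a t]; rewrite /puncons /pcons /=; congr (_, _).
by apply: val_inj.
Qed.

Section step.
Context (n : nat)
  (mu : {sigma_finite_measure set (borelRn n) -> \bar R}).

Definition borel_leb_step : set (borelRn n.+1) -> \bar R :=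
  pushforward ((@lebesgue_measure R) \x mu) (@pcons n).

Let step0 : borel_leb_step set0 = 0.
Proof. by rewrite /borel_leb_step /pushforward preimage_set0 measure0. Qed.

Let step_ge0 A : 0 <= borel_leb_step A.
Proof. by rewrite /borel_leb_step /pushforward; exact: measure_ge0. Qed.

Let step_sigma_additive : semi_sigma_additive borel_leb_step.
Proof.
move=> F mF tF mUF; rewrite /borel_leb_step /pushforward preimage_bigcup.
apply: measure_semi_sigma_additive.
- by move=> k; rewrite -[X in measurable X]setTI; exact: measurable_pcons.
- apply/trivIsetP => /= i j _ _ ij; rewrite -preimage_setI.
  by move/trivIsetP : tF => /(_ _ _ _ _ ij) ->//; rewrite preimage_set0.
- rewrite -preimage_bigcup -[X in measurable X]setTI.
  exact: measurable_pcons.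
Qed.

HB.instance Definition _ := isMeasure.Build _ _ _
  borel_leb_step step0 step_ge0 step_sigma_additive.

Let step_sigma_finite : sigma_finite [set: _] borel_leb_step.
Proof.
have /sigma_finiteP[F [TF ndF Foo]] := sigma_finiteT (@lebesgue_measure R).
have /sigma_finiteP[G [TG ndG Goo]] := sigma_finiteT mu.
exists (fun k => @puncons n @^-1` (F k `*` G k)).
  rewrite -preimage_bigcup; apply/seteqP; split => // x _ /=.
  have [i _ Fi] : (\bigcup_i F i) (puncons x).1 by rewrite -TF.
  have [j _ Gj] : (\bigcup_j G j) (puncons x).2 by rewrite -TG.
  exists (maxn i j) => //; split.
    by move: Fi; exact/subsetPset/ndF/leq_maxl.
  by move: Gj; exact/subsetPset/ndG/leq_maxr.
move=> k; have [mF Fk] := Foo k; have [mG Gk] := Goo k; split.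
  rewrite -[X in measurable X]setTI; apply: measurable_puncons => //.
  exact: measurableX.
rewrite /borel_leb_step /pushforward.
rewrite (_ : _ @^-1` _ = F k `*` G k); last first.
  by apply/funext => z; rewrite /preimage /mkset pconsK.
by rewrite product_measure1E// lte_mul_pinfty// ge0_fin_numE.
Qed.

HB.instance Definition _ := Measure_isSigmaFinite.Build _ _ _
  borel_leb_step step_sigma_finite.

End step.

Fixpoint borel_leb n :
    {sigma_finite_measure set (borelRn n) -> \bar R} :=
  match n with
  | 0%N => [the {sigma_finite_measure set _ -> \bar R} of
            \d_([tuple] : borelRn 0)]
  | m.+1 => [the {sigma_finite_measure set _ -> \bar R} of
             borel_leb_step (borel_leb m)]
  end.

Lemma borel_leb_box n (A : 'I_n -> set (measurableTypeR R)) :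
  (forall i, measurable (A i)) ->
  measurable [set x : borelRn n | forall i, A i (tnth x i)] /\
  borel_leb n [set x | forall i, A i (tnth x i)] =
    \prod_(i < n) lebesgue_measure (A i).
Proof.
elim: n A => [|n IH] A mA.
  have -> : [set x : borelRn 0 | forall i, A i (tnth x i)] = setT.
    by apply/seteqP; split => // x _ [].
  by split => //; rewrite big_ord0 /= diracT.
have [mB IHB] := IH (fun i => A (lift ord0 i)) (fun i => mA _).
have mm : measurable [set x : borelRn n.+1 | forall i, A i (tnth x i)].
  have -> : [set x : borelRn n.+1 | forall i, A i (tnth x i)] =
      \bigcap_(i in [set: 'I_n.+1]) ((fun x : borelRn n.+1 => tnth x i) @^-1` A i).
    by apply/seteqP; split => [x Ax i _|x Ax i]; [exact: Ax|exact: (Ax i I)].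
  apply: fin_bigcap_measurable => // i _.
  by rewrite -[X in measurable X]setTI; exact: measurable_tnth.
split=> //.
rewrite big_ord_recl -IHB -product_measure1E//=.
rewrite /borel_leb_step/pushforward; congr (product_measure1 _ _ _).
apply/seteqP; split => [[a t] /= H|[a t] /= [Ha Ht] i].
  split; first exact: (H ord0).
  by move=> i; have := H (lift ord0 i); rewrite tnthS.
have [->|i0] := eqVneq i ord0; first exact: Ha.
case: (unliftP ord0 i) => [j ->|E]; last by rewrite E eqxx in i0.
by rewrite tnthS; exact: Ht.
Qed.

End borel_lebesgue.

Definition Rn (R : realType) (n : nat) : measurableType _ :=
  caratheodory_type (mu_ext (borel_leb R n)).

Definition leb (R : realType) (n : nat) : {measure set (Rn R n) -> \bar R} :=
  [the {measure set _ -> \bar R} of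
   @completed_measure_extension _ _ _ (borel_leb R n)].
Arguments leb {R n}.

Lemma leb_borel (R : realType) n (A : set (borelRn R n)) : measurable A ->
  @measurable _ (Rn R n) A /\ leb (A : set (Rn R n)) = borel_leb R n A.
Proof.
move=> mA; split; first by apply: sub_caratheodory; exact: sub_sigma_algebra.
by rewrite /leb /= /completed_measure_extension measurable_mu_extE.
Qed.

Definition coord (R : realType) n (x : Rn R n) (i : 'I_n) : R :=
  tnth (x : n.-tuple R) i.

Definition vol (R : realType) n (E : set (Rn R n)) : R := fine (leb E).

(* Cubes are not required to be open or closed: each face may or may not belong
   to the cube. *)
Definition cube (R : realType) n (Q : set (Rn R n)) :=
  exists (l : R) (a : 'I_n -> R) (b c : 'I_n -> bool), 0 < l /\
    Q = [set x | forall i,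
           coord x i \in Interval (BSide (b i) (a i)) (BSide (c i) (a i + l))].

Definition closed_cube (R : realType) n (Q : set (Rn R n)) :=
  exists (l : R) (a : 'I_n -> R), 0 < l /\
    Q = [set x | forall i, coord x i \in `[a i, a i + l]].

Definition bounded_subset (R : realType) n (E : set (Rn R n)) :=
  exists M : R, forall x, E x -> forall i, `|coord x i| <= M.

(* [mmeasure mdeg P] is one plus the degree of P, and 0 for P = 0. *)
Definition polys (R : realType) (n s : nat) : set (mpoly.mpoly n R) :=
  [set P | (mpoly.mmeasure mpoly.mdeg P <= s.+1)%N].
Arguments polys : clear implicits.

Definition peval (R : realType) n (P : mpoly.mpoly n R) (x : Rn R n) : R :=
  mpoly.meval (coord x) P.

Definition monom (R : realType) n (g : mpoly.multinom n) (x : Rn R n) : R :=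
  \prod_(i < n) coord x i ^+ g i.

(* P_Q^(s)(f); the polynomial is unique for f integrable on the cube Q, and
   [xget] selects it. *)
Definition moment_proj (R : realType) n (s : nat) (Q : set (Rn R n))
    (f : Rn R n -> R) : mpoly.mpoly n R :=
  xget 0 [set P | polys R n s P /\
    forall g : mpoly.multinom n, (mpoly.mdeg g <= s)%N ->
      (\int[leb]_(x in Q) ((f x - peval P x) * monom g x)%:E = 0)%E].

Definition residual (R : realType) n (s : nat) (Q : set (Rn R n))
    (f : Rn R n -> R) : Rn R n -> R :=
  fun x => f x - peval (moment_proj s Q f) x.

(* [avg_norm q Q f] is (|Q|^-1 \int_Q |f|^q)^(1/q). *)
Definition avg_norm (R : realType) n (q : R) (Q : set (Rn R n))
    (f : Rn R n -> R) : \bar R :=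
  (((vol Q)^-1%:E * \int[leb]_(x in Q) (`|f x| `^ q)%:E) `^ q^-1)%E.

Definition L1loc (R : realType) n (Q0 : set (Rn R n)) : set (Rn R n -> R) :=
  [set f : Rn R n -> R | measurable_fun Q0 f /\
    forall E, measurable E -> E `<=` Q0 -> bounded_subset E ->
      leb.-integrable Q0 (fun x => (f x * \1_E x)%:E)].

Definition Lq (R : realType) n (q : R) (Q0 : set (Rn R n)) :
    set (Rn R n -> R) :=
  [set f : Rn R n -> R | measurable_fun Q0 f /\
    (\int[leb]_(x in Q0) (`|f x| `^ q)%:E < +oo)%E].

(* Functions on a cube are represented by total functions on R^n, of which only
   the values on the cube matter in the instances [JN] and [Lq_mod]. *)
Record fun_space (R : realType) (n : nat) := FunSpace {
  carrier : set (Rn R n -> R);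
  snorm : (Rn R n -> R) -> \bar R }.

Definition scale_space (R : realType) n (A : R) (X : fun_space R n) :=
  FunSpace [set (fun x => A * f x) | f in carrier X]
           (fun f => (A%:E * snorm X f)%E).

Definition disjoint_cubes (R : realType) n (Q0 : set (Rn R n)) :
    set (set (set (Rn R n))) :=
  [set C | (forall Q, C Q -> cube Q /\ Q `<=` Q0) /\ trivIset C id].

Definition JN_norm (R : realType) n (p q : R) (s : nat) (alpha : R)
    (Q0 : set (Rn R n)) (f : Rn R n -> R) : \bar R :=
  ((ereal_sup
    [set \esum_(Q in C) ((vol Q)%:E *
        ((powR (vol Q) (- alpha))%:E *
         avg_norm q Q (residual s Q f)) `^ p)
    | C in disjoint_cubes Q0]) `^ p^-1)%E.

Definition JN (R : realType) n (p q : R) (s : nat) (alpha : R)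
    (Q0 : set (Rn R n)) : fun_space R n :=
  FunSpace [set f | L1loc Q0 f /\ (JN_norm p q s alpha Q0 f < +oo)%E]
           (JN_norm p q s alpha Q0).

Definition Lq_mod_norm (R : realType) n (q : R) (s : nat) (Q0 : set (Rn R n))
    (f : Rn R n -> R) : \bar R :=
  ereal_inf [set avg_norm q Q0 (fun x => (f x + peval m x)%R) | m in polys R n s].

Definition Lq_mod (R : realType) n (q : R) (s : nat) (Q0 : set (Rn R n)) :
    fun_space R n :=
  FunSpace [set f | Lq q Q0 f /\ (Lq_mod_norm q s Q0 f < +oo)%E]
           (Lq_mod_norm q s Q0).

Definition eq_equiv_norms (R : realType) n (X Y : fun_space R n) :=
  carrier X = carrier Y /\
  exists c C : R, [/\ 0 < c, 0 < C & forall f, carrier X f ->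
    (c%:E * snorm Y f <= snorm X f)%E /\ (snorm X f <= C%:E * snorm Y f)%E].

(* Main.v *)
(* Applied to the single cube Q0, the John-Nirenberg-Campanato norm dominates
   the L^q norm of f - P_{Q0}(f), hence the quotient norm.

   Conversely, let g = f + m with m a polynomial of degree at most s.  In the
   rescaled monomials ((x - a)/l)^gamma on a cube Q with corner a and edge l,
   the normalized Gram matrix has entries prod_i 1/(gamma_i + delta_i + 1),
   which do not depend on Q, so |P_Q(g)| is at most K times the average of |g|
   over Q with K independent of Q.  As f - P_Q(f) = g - P_Q(g) almost
   everywhere, avg_Q |f - P_Q(f)|^q <= L avg_Q |g|^q.  Since p <= q, summing
   |Q| (avg_Q |g|^q)^(p/q) over disjoint cubes of Q0 gives at most
   2 |Q0| (avg_{Q0} |g|^q)^(p/q).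

   The crude bounds t <= 1 + t^q and t^(p/q) <= 1 + t, applied at the right
   scale, replace the Hoelder and Jensen inequalities at the cost of a factor 2. *)

Require Import Defs.
From HB Require Import structures.
From mathcomp Require Import all_boot all_order all_algebra.
From mathcomp Require Import all_classical all_reals all_analysis measurable_realfun.
From mathcomp Require Import ring lra.
From mathcomp Require mpoly.
Import (canonicals, coercions) mpoly.
Set Implicit Arguments.
Unset Strict Implicit.
Unset Printing Implicit Defensive.
Import Order.TTheory GRing.Theory Num.Theory.
Import numFieldNormedType.Exports.
Local Open Scope classical_set_scope.
Local Open Scope ring_scope.

(** * Polynomials *)

Lemma polysP (R : realType) (n s : nat) (P : mpoly.mpoly n R) :
  polys R n s P <-> (mpoly.mmeasure mpoly.mdeg P <= s.+1)%N.
Proof. by []. Qed.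

Lemma polys0 (R : realType) (n s : nat) : polys R n s 0.
Proof. by apply/polysP; rewrite mpoly.mmeasure0. Qed.

Lemma polysD (R : realType) (n s : nat) (P Q : mpoly.mpoly n R) :
  polys R n s P -> polys R n s Q -> polys R n s (P + Q).
Proof.
move=> /polysP hP /polysP hQ; apply/polysP.
by apply: leq_trans (mpoly.mmeasureD_le _ _ _) _; rewrite geq_max hP hQ.
Qed.

Lemma polysN (R : realType) (n s : nat) (P : mpoly.mpoly n R) :
  polys R n s P -> polys R n s (- P).
Proof. by move=> /polysP hP; apply/polysP; rewrite mpoly.mmeasureN. Qed.

Lemma polysZ (R : realType) (n s : nat) (c : R) (P : mpoly.mpoly n R) :
  polys R n s P -> polys R n s (c *: P).
Proof.
by move=> /polysP hP; apply/polysP; apply: leq_trans (mpoly.mmeasureZ_le _ _ _) _.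
Qed.

Lemma polys_sum (R : realType) (n s : nat) (I : Type) (r : seq I)
    (F : I -> mpoly.mpoly n R) :
  (forall i, polys R n s (F i)) -> polys R n s (\sum_(i <- r) F i).
Proof.
move=> hF; apply: (big_ind (polys R n s)) => //; first exact: polys0.
exact: polysD.
Qed.

Lemma meval_polys (R : realType) (n s : nat) (P : mpoly.mpoly n R)
    (y : 'I_n -> R) : polys R n s P ->
  mpoly.meval y P = \sum_(d : mpoly.bmultinom n s.+1)
    mpoly.mcoeff (mpoly.bmnm d) P * \prod_(i < n) y i ^+ (mpoly.bmnm d) i.
Proof.
move=> /polysP hP; rewrite {1}(mpoly.mpolywE hP) raddf_sum /=.
by apply: eq_bigr => d _; rewrite mpoly.mevalZ mpoly.mevalX.
Qed.

(** Each variable is replaced by a form [L i] of degree at most 1, so no monomial gains degree. This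
    serves to pass between the coordinates and the rescaled coordinates of a cube, in both
    directions. *)
Lemma polys_affine (R : realType) (n s : nat) (u v : 'I_n -> R)
    (P : mpoly.mpoly n R) : polys R n s P ->
  exists2 P' : mpoly.mpoly n R, polys R n s P' &
    forall y, mpoly.meval y P' = mpoly.meval (fun i => u i + v i * y i) P.
Proof.
move=> hP.
pose L (i : 'I_n) : mpoly.mpoly n R :=
  mpoly.mpolyC n (u i) + v i *: mpoly.mpolyX R (mpoly.mnm1 i).
have Ly i y : mpoly.meval y (L i) = u i + v i * y i.
  by rewrite mpoly.mevalD mpoly.mevalC mpoly.mevalZ mpoly.mevalXU.
have hL i : (mpoly.mmeasure mpoly.mdeg (L i) <= 2)%N.
  apply: leq_trans (mpoly.mmeasureD_le _ _ _) _; rewrite geq_max.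
  rewrite mpoly.mmeasureC; apply/andP; split; first by case: eqP.
  apply: leq_trans (mpoly.mmeasureZ_le _ _ _) _.
  by rewrite mpoly.mmeasureX /= mpoly.mdeg1.
(* [mmeasure mdeg] is the degree plus one, so the size of a product is the sum of the sizes minus
   one. The formula requires nonzero factors, hence the separate treatment of 0. *)
have hM (p1 p2 : mpoly.mpoly n R) k1 k2 :
    (mpoly.mmeasure mpoly.mdeg p1 <= k1.+1)%N ->
    (mpoly.mmeasure mpoly.mdeg p2 <= k2.+1)%N ->
    (mpoly.mmeasure mpoly.mdeg (p1 * p2) <= (k1 + k2).+1)%N.
  move=> h1 h2; have [->|p10] := eqVneq p1 0.
    by rewrite mul0r mpoly.mmeasure0.
  have [->|p20] := eqVneq p2 0; first by rewrite mulr0 mpoly.mmeasure0.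
  rewrite mpoly.msizeM//.
  by rewrite -subn1 leq_subLR add1n; move: (leq_add h1 h2); rewrite addSn addnS.
have hX (p1 : mpoly.mpoly n R) k :
    (mpoly.mmeasure mpoly.mdeg p1 <= 2)%N ->
    (mpoly.mmeasure mpoly.mdeg (p1 ^+ k) <= k.+1)%N.
  move=> h1; elim: k => [|k IH]; first by rewrite expr0 mpoly.mmeasure1 ?mpoly.mdeg0.
  by rewrite exprS; exact: (hM _ _ 1%N k).
pose P' := \sum_(d : mpoly.bmultinom n s.+1)
   mpoly.mcoeff (mpoly.bmnm d) P *: \prod_(i < n) L i ^+ (mpoly.bmnm d) i.
exists P'.
  apply: polys_sum => d; apply: polysZ; apply/polysP.
  apply: (@leq_trans (mpoly.mdeg (mpoly.bmnm d)).+1); last exact: mpoly.bmdeg.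
  rewrite mpoly.mdegE.
  apply: (big_ind2 (fun (p : mpoly.mpoly n R) k =>
    (mpoly.mmeasure mpoly.mdeg p <= k.+1)%N)) => [|p1 k1 p2 k2|i _].
  - by rewrite mpoly.mmeasure1 ?mpoly.mdeg0.
  - exact: hM.
  - exact: hX.
move=> y; rewrite (meval_polys _ hP) raddf_sum /=.
apply: eq_bigr => d _; rewrite mpoly.mevalZ; congr (_ * _).
rewrite rmorph_prod; apply: eq_bigr => i _.
by rewrite rmorphXn /= Ly.
Qed.

(** * Projection onto a finite family *)

Section gram.
Context (d : measure_display) (T : measurableType d) (R : realType)
  (mu : {measure set T -> \bar R}) (D : set T).
Hypotheses (mD : measurable D) (muD : (mu D < +oo)%E).

Lemma integrable_cst (k : R) : mu.-integrable D (EFin \o cst k).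
Proof.
apply/integrableP; split; first exact/measurable_EFinP/measurable_cst.
under eq_integral do rewrite /= .
rewrite integral_cst//= lte_mul_pinfty//.
Qed.

Lemma integrable_mul_bounded (f h : T -> R) (M : R) :
  mu.-integrable D (EFin \o f) -> measurable_fun D h ->
  (forall x, D x -> `|h x| <= M) ->
  mu.-integrable D (EFin \o (fun x => f x * h x)).
Proof.
move=> intf mh hM; have mf : measurable_fun D f.
  by apply/measurable_EFinP; exact: measurable_int intf.
apply: (le_integrable mD _ _ (integrableZl mD M intf)).
  by apply/measurable_EFinP; exact: measurable_funM.
move=> x Dx /=; rewrite lee_fin !normrM mulrC ler_wpM2r//.
by apply: le_trans (hM _ Dx) _; exact: ler_norm.
Qed.

Lemma Rintegral_sum (I : Type) (r : seq I) (f : I -> T -> R) :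
  (forall i, mu.-integrable D (EFin \o f i)) ->
  \int[mu]_(x in D) (\sum_(i <- r) f i x) =
  \sum_(i <- r) \int[mu]_(x in D) f i x.
Proof.
move=> intf; rewrite /Rintegral.
under eq_integral do rewrite -sumEFin.
rewrite integral_sum// -sum_fine// => i _.
by apply: integrable_fin_num => //; exact: intf.
Qed.

Lemma integrable_sum_EFin (I : Type) (r : seq I) (f : I -> T -> R) :
  (forall i, mu.-integrable D (EFin \o f i)) ->
  mu.-integrable D (EFin \o (fun x => \sum_(i <- r) f i x)).
Proof.
move=> intf.
rewrite (_ : _ \o _ = (fun x => (\sum_(i <- r) (f i x)%:E)%E)).
  by apply: integrable_sum => // i _; exact: intf.
by apply/funext => x /=; rewrite sumEFin.
Qed.

Lemma Rintegral_sqr_eq0 (f : T -> R) :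
  measurable_fun D f -> mu.-integrable D (EFin \o (fun x => f x * f x)) ->
  \int[mu]_(x in D) (f x * f x) = 0 -> ae_eq mu D f (cst 0).
Proof.
move=> mf intf I0.
have /(ae_eq_integral_abs mu mD) : measurable_fun D (fun x => (f x * f x)%:E).
  by apply/measurable_EFinP; exact: measurable_funM.
move=> [H _]; apply: filterS (H _) => [x /= + Dx|].
  by move=> /(_ Dx) [] /eqP; rewrite mulf_eq0 orbb => /eqP.
rewrite -[RHS]/(0%:E) -I0 /Rintegral fineK; last exact: integrable_fin_num.
apply: eq_integral => x _ /=.
by rewrite ger0_norm// -expr2 sqr_ge0.
Qed.

Lemma ae_eq0_Rintegral (f : T -> R) : measurable_fun D f ->
  ae_eq mu D f (cst 0) -> \int[mu]_(x in D) f x = 0.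
Proof.
move=> mf f0; rewrite /Rintegral (ae_eq_integral (cst 0%E))//.
- by rewrite integral0.
- exact/measurable_EFinP.
- by apply: filterS f0 => x /= + Dx => /(_ Dx) ->.
Qed.

Section basis.
Context (N : nat) (e : 'I_N -> T -> R).
Hypotheses (me : forall i, measurable_fun D (e i))
  (e1 : forall i x, D x -> `|e i x| <= 1).
Hypothesis (muD0 : (0 < mu D)%E).

Let V := fine (mu D).
Let V0 : 0 < V. Proof. by rewrite fine_gt0// muD0 muD. Qed.

(** Dividing by the measure of [D] is what makes this matrix the same for all cubes once the family
    consists of rescaled monomials. *)
Definition gram : 'M[R]_N :=
  \matrix_(i, j) (V^-1 * \int[mu]_(x in D) (e i x * e j x)).

Let int_e i : mu.-integrable D (EFin \o e i).
Proof.
have := @integrable_mul_bounded (cst 1) (e i) 1 (integrable_cst 1) (me i) (@e1 i).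
by apply: eq_integrable => // x _ /=; rewrite mul1r.
Qed.

Definition comb (v : 'I_N -> R) (x : T) := \sum_i v i * e i x.

Lemma measurable_comb v : measurable_fun D (comb v).
Proof. by apply: measurable_sum => i; exact: measurable_funM. Qed.

Lemma comb_bounded v x : D x -> `|comb v x| <= \sum_i `|v i|.
Proof.
move=> Dx; apply: le_trans (ler_norm_sum _ _ _) _; apply: ler_sum => i _.
by rewrite normrM ler_piMr// e1.
Qed.

Lemma integrable_comb v : mu.-integrable D (EFin \o comb v).
Proof.
apply: integrable_sum_EFin => i.
exact: (integrableZl mD (v i) (int_e i)).
Qed.

Lemma Rintegral_mul_comb (g : T -> R) v : mu.-integrable D (EFin \o g) ->
  \int[mu]_(x in D) (g x * comb v x) =
  \sum_i v i * \int[mu]_(x in D) (g x * e i x).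
Proof.
move=> ig.
have ige i : mu.-integrable D (EFin \o (fun x => g x * e i x)).
  exact: integrable_mul_bounded ig (me i) (@e1 i).
transitivity (\int[mu]_(x in D) \sum_i v i * (g x * e i x)).
  apply: eq_Rintegral => x _; rewrite mulr_sumr.
  by apply: eq_bigr => i _; rewrite mulrCA.
rewrite Rintegral_sum//; last by move=> i; exact: (integrableZl mD (v i) (ige i)).
by apply: eq_bigr => i _; rewrite RintegralZl.
Qed.

(* A vector in the kernel of the Gram matrix is a combination that vanishes
   almost everywhere, hence is orthogonal to the moments of g: the normal
   equations are solvable whether or not the Gram matrix is invertible. *)
Lemma gram_projection (g : T -> R) : mu.-integrable D (EFin \o g) ->
  exists v : 'I_N -> R,
    (forall j, \int[mu]_(x in D) ((g x - comb v x) * e j x) = 0) /\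
    (forall i, `|v i| <= (\sum_j \sum_k `|pinvmx gram j k|) *
                         (V^-1 * \int[mu]_(x in D) `|g x|)).
Proof.
move=> ig.
have ige i : mu.-integrable D (EFin \o (fun x => g x * e i x)).
  exact: integrable_mul_bounded ig (me i) (@e1 i).
have mg : measurable_fun D g by apply/measurable_EFinP; exact: measurable_int ig.
pose b : 'rV[R]_N := \row_j (V^-1 * \int[mu]_(x in D) (g x * e j x)).
have bG : (b <= gram)%MS.
  rewrite submxE; apply/eqP/matrixP => i0 k; rewrite [LHS]mxE [RHS]mxE.
  (* Membership in the row space is tested against the columns of the cokernel. Each such column [v]
     is a vector of the kernel of the Gram matrix. *)
  pose v i := cokermx gram i k.
  have Gv i : \sum_j v j * \int[mu]_(x in D) (e i x * e j x) = 0.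
    have /matrixP/(_ i k) := mulmx_coker gram; rewrite [LHS]mxE [RHS]mxE => /eqP.
    under eq_bigr do rewrite [gram _ _]mxE -mulrA.
    rewrite -mulr_sumr mulf_eq0 invr_eq0 gt_eqF//= => /eqP G0.
    by rewrite -[RHS]G0; apply: eq_bigr => j _; rewrite mulrC.
  (* The integral of the square of [comb v] is, up to the factor $V$, the quadratic form of the Gram
     matrix at [v], and so it is zero. *)
  have v0 : ae_eq mu D (comb v) (cst 0).
    apply: Rintegral_sqr_eq0; first exact: measurable_comb.
      apply: integrable_mul_bounded (integrable_comb v) (measurable_comb v) _.
      by move=> x; exact: comb_bounded.
    rewrite Rintegral_mul_comb; last exact: integrable_comb.
    apply: big1 => i _.
    under eq_Rintegral do rewrite mulrC.
    by rewrite Rintegral_mul_comb// Gv mulr0.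
  transitivity (V^-1 * \sum_i v i * \int[mu]_(x in D) (g x * e i x)).
    rewrite mulr_sumr; apply: eq_bigr => i _.
    by rewrite [b _ _]mxE -mulrA (mulrC _ (v i)).
  rewrite [X in _ * X](_ : _ = 0) ?mulr0//.
  rewrite -(@Rintegral_mul_comb _ v)//; apply: ae_eq0_Rintegral.
    by apply: measurable_funM => //; exact: measurable_comb.
  by apply: filterS v0 => x /= + Dx => /(_ Dx) ->; rewrite mulr0.
(* Since [b] lies in the row space, the pseudo-inverse gives a solution of $cG = b$ for a singular
   $G$ too, with coefficients controlled by the entries of [pinvmx gram]. *)
pose c : 'rV[R]_N := b *m pinvmx gram.
exists (fun i => c 0 i); split=> [j|i].
  have := mulmxKpV bG => /matrixP/(_ 0 j); rewrite -/c !mxE => cG.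
  have -> : \int[mu]_(x in D) ((g x - comb (c 0) x) * e j x) =
      \int[mu]_(x in D) (g x * e j x) - \int[mu]_(x in D) (e j x * comb (c 0) x).
    rewrite -RintegralB//; last first.
      apply: integrable_mul_bounded (int_e j) (measurable_comb _) _.
      by move=> x; exact: comb_bounded.
    by apply: eq_Rintegral => x _; ring.
  rewrite Rintegral_mul_comb//; apply: (@mulfI _ V^-1).
    by rewrite invr_neq0// gt_eqF.
  rewrite mulr0 mulrBr -cG mulr_sumr; apply/eqP; rewrite subr_eq0; apply/eqP.
  apply: eq_bigr => i _; rewrite !mxE.
  under [in RHS]eq_Rintegral do rewrite mulrC.
  by ring.
have bg k : `|b 0 k| <= V^-1 * \int[mu]_(x in D) `|g x|.
  rewrite mxE normrM ger0_norm ?invr_ge0 ?(ltW V0)// ler_wpM2l ?invr_ge0 ?(ltW V0)//.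
  apply: le_trans (le_normr_Rintegral mD (ige k)) _; apply: le_Rintegral => //.
  - exact: integrable_norm (ige k).
  - exact: integrable_norm.
  - by move=> x Dx; rewrite normrM ler_piMr// e1.
rewrite mxE; apply: le_trans (ler_norm_sum _ _ _) _.
rewrite mulr_suml; apply: ler_sum => k _.
rewrite normrM mulrC; apply: ler_pM => //.
(* One entry is bounded by the sum of its row, which gives a bound that does not depend on [i]. *)
by rewrite (bigD1 i)//= lerDl sumr_ge0.
Qed.

End basis.
End gram.

(** * Integrals over boxes *)

Section borel_product.
Local Open Scope ereal_scope.
Context (R : realType).

Lemma measurable_Rn_borel n :
  measurable_fun [set: Rn R n] (id : Rn R n -> borelRn R n).
Proof. by move=> _ A mA; rewrite setTI; have [] := leb_borel mA. Qed.

(** The identity from the Lebesgue to the Borel structure is measurable and pushes [leb] forward to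
    [borel_leb]. Integrals of Borel functions can thus be computed with the inductively built
    product measure. *)
Lemma ge0_integral_leb n (D : set (borelRn R n)) (f : borelRn R n -> \bar R) :
  measurable D -> measurable_fun D f -> (forall x, D x -> 0 <= f x) ->
  \int[leb]_(x in (D : set (Rn R n))) f x = \int[borel_leb R n]_(x in D) f x.
Proof.
move=> mD mf f0.
have := ge0_integral_pushforward (@measurable_Rn_borel n) leb mD mf.
rewrite preimage_id => <-; last by move=> x; rewrite inE; exact: f0.
have lebE A : measurable A -> A `<=` D ->
    pushforward leb (id : Rn R n -> borelRn R n) A = borel_leb R n A.
  by move=> mA _; exact: (leb_borel mA).2.
apply: (@eq_measure_integral _ _ R D (borel_leb R n) _ f) lebE.
exact: measurable_Rn_borel.
Qed.

(** Induction on [n]: the measure in dimension $n+1$ is the image under [pcons] of a product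
    measure, so after a change of variables Tonelli's theorem splits off the first factor. *)
Lemma integral_borel_leb_prod n (phi : 'I_n -> measurableTypeR R -> R) :
  (forall i, measurable_fun setT (phi i)) -> (forall i t, (0 <= phi i t)%R) ->
  \int[borel_leb R n]_x (\prod_(i < n) phi i (tnth x i))%:E =
  \prod_(i < n) \int[lebesgue_measure]_t (phi i t)%:E.
Proof.
have mF m (psi : 'I_m -> measurableTypeR R -> R) :
    (forall i, measurable_fun setT (psi i)) ->
    measurable_fun [set: borelRn R m] (fun x => \prod_(i < m) psi i (tnth x i))%R.
  move=> mpsi; apply: measurable_prod => i _.
  by apply: measurableT_comp (mpsi i) _; exact: measurable_tnth.
have F0 m (psi : 'I_m -> measurableTypeR R -> R) (x : borelRn R m) :
    (forall i t, 0 <= psi i t)%R -> (0 <= \prod_(i < m) psi i (tnth x i))%R.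
  by move=> psi0; apply: prodr_ge0 => i _; exact: psi0.
elim: n phi => [|n IH] phi mphi phi0.
  rewrite /= integral_dirac//; last first.
    by apply/measurable_EFinP; apply: mF.
  by rewrite !big_ord0 diracT mul1e.
rewrite [LHS](@ge0_integral_pushforward _ _ _ _ _ _ (@measurable_pcons R n)
  _ setT (fun x => (\prod_(i < n.+1) phi i (tnth x i))%:E))//; last 2 first.
- by apply/measurable_EFinP; apply: mF.
- by move=> x _; rewrite lee_fin; exact: F0.
rewrite preimage_setT fubini_tonelli1/=; last 2 first.
- apply/measurable_EFinP; apply: (measurableT_comp (mF _ _ mphi)).
  exact: measurable_pcons.
- by move=> x; rewrite lee_fin; exact: F0.
rewrite big_ord_recl -IH//.
have I0 : 0 <= \int[borel_leb R n]_x (\prod_(i < n) phi (lift ord0 i) (tnth x i))%:E.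
  by apply: integral_ge0 => x _; rewrite lee_fin; exact: (F0 _ (fun i => phi (lift ord0 i))).
rewrite -ge0_integralZr//; last 2 first.
- exact/measurable_EFinP.
- by move=> t _; rewrite lee_fin.
apply: eq_integral => t _; rewrite /fubini_F/= -ge0_integralZl_EFin//; last 2 first.
- by move=> x _; rewrite lee_fin; exact: (F0 _ (fun i => phi (lift ord0 i))).
- by apply/measurable_EFinP; exact: (mF _ (fun i => phi (lift ord0 i))).
apply: eq_integral => x _; rewrite -EFinM big_ord_recl; congr (_ * _)%R%:E.
by apply: eq_bigr => i _; rewrite tnthS.
Qed.

(** Endpoints are null sets, so the four kinds of interval reduce to the closed one, where the
    fundamental theorem of calculus applies to the primitive $\frac{l}{k+1}((t-a)/l)^{k+1}$. *)
Lemma integral_itv_monomial (a l : R) (b c : bool) k : (0 < l)%R ->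
  \int[lebesgue_measure]_(t in [set` Interval (BSide b a) (BSide c (a + l)%R)])
    (((t - a) / l) ^+ k)%:E = (l / k.+1%:R)%:E.
Proof.
move=> l0.
have mf (D : set R) : measurable_fun D (fun t => ((t - a) / l) ^+ k)%R.
  by apply: measurable_funX; apply: measurable_funM => //; exact: measurable_funB.
transitivity (\int[lebesgue_measure]_(t in `[a, (a + l)%R]) (((t - a) / l) ^+ k)%:E).
  have mf' (D : set R) : measurable_fun D (fun t => (((t - a) / l) ^+ k)%:E)%R.
    exact/measurable_EFinP.
  by case: b; case: c; rewrite ?integral_itv_obnd_cbnd// ?integral_itv_bndo_bndc//.
pose F := (fun t : R => l / k.+1%:R * ((t - a) / l) ^+ k.+1)%R.
have dF t : is_derive t (1 : R)%R F (((t - a) / l) ^+ k)%R.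
  have -> : F = ((l / k.+1%:R) *: (l^-1 *: (id - cst a)) ^+ k.+1)%R.
    by apply/funext => u; rewrite /F !fctE /= /GRing.scale/= (mulrC (l^-1)%R).
  apply: is_derive_eq; rewrite !fctE /GRing.scale/= subr0 (mulrC (l^-1)%R).
  rewrite mulr1 mulrACA -(mulrC (l^-1)%R) mulrA.
  move: (_ ^+ k)%R => e; field.
  by rewrite (gt_eqF l0)/= nat1r pnatr_eq0.
have cF : continuous F.
  by move=> u; apply: differentiable_continuous; apply/derivable1_diffP; exact: ex_derive.
rewrite (@continuous_FTC2 _ _ F) ?ltrDl//.
- rewrite /F (_ : a + l - a = l)%R; last by ring.
  rewrite divff ?gt_eqF// expr1n mulr1 subrr mul0r.
  by rewrite expr0n/= mulr0 sube0.
- apply: continuous_subspaceT => u; apply: differentiable_continuous.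
  apply/derivable1_diffP.
  have -> : (fun t => ((t - a) / l) ^+ k)%R = ((l^-1 *: (id - cst a)) ^+ k)%R.
    by apply/funext => t; rewrite !fctE /= /GRing.scale/= (mulrC (l^-1)%R).
  exact: ex_derive.
- split.
  + by move=> t _; exact: ex_derive.
  + exact/cvg_at_right_filter/cF.
  + exact/cvg_at_left_filter/cF.
- by move=> u _; rewrite derive1E derive_val.
Qed.
End borel_product.

(** * Cubes with explicit parameters and their rescaled monomials *)

(** This is the set described in [cube], with corner, edge and choice of faces as arguments, so that
    constants can be seen not to depend on them. *)
Definition box (R : realType) (n : nat) (l : R) (a : 'I_n -> R)
    (b c : 'I_n -> bool) : set (Rn R n) :=
  [set x | forall i,
     Defs.coord x i \in Interval (BSide (b i) (a i)) (BSide (c i) (a i + l))].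

Definition rescale (R : realType) (n : nat) (l : R) (a : 'I_n -> R)
    (x : Rn R n) (i : 'I_n) : R := (Defs.coord x i - a i) / l.

Lemma measurable_coord (R : realType) (n : nat) (D : set (Rn R n)) (i : 'I_n) :
  measurable D -> measurable_fun D (fun x => Defs.coord x i).
Proof.
move=> mD; apply: (measurable_funS measurableT); first exact: subsetT.
exact: (measurableT_comp (@measurable_tnth _ (measurableTypeR R) n i)
  (@measurable_Rn_borel R n)).
Qed.

Section boxes.
Context (R : realType) (n : nat) (l : R) (a : 'I_n -> R) (b c : 'I_n -> bool).
Hypothesis l0 : 0 < l.
Let Q := box l a b c.

Let I (i : 'I_n) : set (measurableTypeR R) :=
  [set` Interval (BSide (b i) (a i)) (BSide (c i) (a i + l))].

Let mI i : measurable (I i). Proof. exact: measurable_itv. Qed.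

Lemma measurable_box_borel : measurable (Q : set (borelRn R n)).
Proof. by have [] := borel_leb_box mI. Qed.

Lemma measurable_box : measurable Q.
Proof. by have [] := leb_borel measurable_box_borel. Qed.

Lemma rescale01 x i : Q x -> 0 <= rescale l a x i <= 1.
Proof.
move=> /(_ i); rewrite in_itv /rescale => H.
apply/andP; split; [rewrite divr_ge0 ?(ltW l0)// | rewrite ler_pdivrMr// mul1r].
  by move: H; case: (b i); case: (c i) => /andP[] /=; lra.
by move: H; case: (b i); case: (c i) => /andP[] /=; lra.
Qed.

Lemma integral_box_monomial (k : 'I_n -> nat) :
  (\int[leb]_(x in Q) (\prod_(i < n) rescale l a x i ^+ k i)%:E =
   (\prod_(i < n) (l / (k i).+1%:R))%:E)%E.
Proof.
have mf : measurable_fun (Q : set (borelRn R n))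
    (fun x : borelRn R n => (\prod_(i < n) ((tnth x i - a i) / l) ^+ k i)%:E).
  apply/measurable_EFinP; apply: measurable_prod => i _.
  apply: measurable_funX; apply: measurable_funM => //; apply: measurable_funB => //.
  by apply: (measurable_funS measurableT) => //; exact: measurable_tnth.
rewrite (ge0_integral_leb measurable_box_borel mf); last first.
  move=> x Qx; rewrite lee_fin; apply: prodr_ge0 => i _; apply: exprn_ge0.
  by have /andP[] := @rescale01 x i Qx.
(* The indicator of the box is the product of the indicators of its sides. Absorbing it into the
   factors turns the integrand into a product on the whole space; outside the box one factor
   vanishes. *)
pose phi i : measurableTypeR R -> R := (fun t => ((t - a i) / l) ^+ k i) \_ (I i).
rewrite integral_mkcond.
transitivity (\int[borel_leb R n]_x (\prod_(i < n) phi i (tnth x i))%:E)%E.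
  apply: eq_integral => x _; rewrite patchE /phi.
  have [Qx|nQx] := pselect (Q x).
    rewrite mem_set//; congr EFin; apply: eq_bigr => i _.
    by rewrite patchE mem_set//; exact: Qx.
  rewrite memNset//; have /existsNP[i nI] := nQx.
  by rewrite (bigD1 i)//= patchE memNset// mul0r.
have mphi0 (D : set (measurableTypeR R)) i :
    measurable_fun D (fun t : measurableTypeR R => ((t - a i) / l) ^+ k i).
  by apply: measurable_funX; apply: measurable_funM => //; exact: measurable_funB.
rewrite integral_borel_leb_prod.
- rewrite -prodEFin; apply: eq_bigr => i _.
  rewrite -(integral_itv_monomial (a i) (b i) (c i) (k i) l0) [RHS]integral_mkcond.
  by apply: eq_integral => t _; rewrite restrict_EFin.
- by move=> i; apply/(measurable_restrictT _ (mI i)).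
- move=> i t; rewrite /phi patchE; case: ifPn => // /set_mem It.
  apply: exprn_ge0; apply: divr_ge0; last exact: ltW.
  have := It; rewrite /I/= subr_ge0 in_itv.
  by case: (b i); case: (c i) => /andP[] /=; lra.
Qed.

(** The case of the zero exponent of the monomial integral. *)
Lemma leb_box : leb Q = (l ^+ n)%:E.
Proof.
have := integral_box_monomial (fun=> 0%N).
rewrite (eq_integral (cst 1%E)); last by move=> x _; rewrite big1.
rewrite integral_cst ?mul1e//; last exact: measurable_box.
move=> ->; congr EFin.
by under eq_bigr do rewrite divr1; rewrite prodr_const card_ord.
Qed.

Lemma vol_box : vol Q = l ^+ n. Proof. by rewrite /vol leb_box. Qed.

(** The type [bmultinom n s.+1] holds the multi-indices of degree less than $s+1$, that is, at most
    $s$. Enumerating it indexes the family by an ordinal, as matrices require. *)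
Definition monomial_basis s (i : 'I_#|{: mpoly.bmultinom n s.+1}|)
    (x : Rn R n) : R :=
  \prod_(j < n) rescale l a x j ^+ mpoly.bmnm (enum_val i) j.

Let e := monomial_basis.

Lemma measurable_monomial_basis s i : measurable_fun Q (@e s i).
Proof.
apply: measurable_prod => j _; apply: measurable_funX.
apply: measurable_funM; last exact: measurable_cst.
apply: measurable_funB; last exact: measurable_cst.
exact: measurable_coord measurable_box.
Qed.

Lemma monomial_basis_le1 s i x : Q x -> `|@e s i x| <= 1.
Proof.
move=> Qx; rewrite /e /monomial_basis normr_prod.
apply: prodr_ile1 => j _; rewrite normr_ge0 normrX.
have /andP[h0 h1] := rescale01 j Qx.
by rewrite exprn_ile1// ger0_norm.
Qed.

(** The $n$ edge lengths produced by integration cancel the volume $l^n$. The right-hand side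
    involves neither the position nor the size of the cube, and this is the source of all uniform
    constants. *)
Lemma gram_monomial_basis s : gram leb Q (@e s) =
  \matrix_(i, j) \prod_(k < n)
    (mpoly.bmnm (enum_val i) k + mpoly.bmnm (enum_val j) k).+1%:R^-1.
Proof.
apply/matrixP => i j; rewrite !mxE leb_box/= /Rintegral.
under eq_integral => x _ do rewrite -big_split/=.
under eq_integral => x _ do under eq_bigr => k _ do rewrite -exprD.
rewrite (integral_box_monomial (fun k => mpoly.bmnm (enum_val i) k + mpoly.bmnm (enum_val j) k)%N)/=.
by rewrite big_split/= prodr_const card_ord mulKf// expf_neq0// gt_eqF.
Qed.

(** The coefficients are those of $P(a + l y)$ as a polynomial in $y$, evaluated at $y =
    (x-a)/l$. *)
Lemma peval_comb s (P : mpoly.mpoly n R) : polys R n s P ->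
  exists v, forall x, peval P x = comb (@e s) v x.
Proof.
move=> sP; have [P' sP' PP'] := polys_affine a (fun=> l) sP.
exists (fun i => mpoly.mcoeff (mpoly.bmnm (enum_val i)) P') => x.
transitivity (mpoly.meval (rescale l a x) P').
  rewrite PP'; apply: mpoly.meval_eq => i.
  by rewrite /rescale mulrC divfK ?gt_eqF// addrC subrK.
rewrite (meval_polys _ sP') /comb (reindex _ (onW_bij _ (@enum_val_bij _)))/=.
exact: eq_bigr.
Qed.

(** Converse direction, by the inverse substitution $y = -a/l + x/l$. *)
Lemma comb_peval s v : exists2 P, polys R n s P &
  forall x, peval P x = comb (@e s) v x.
Proof.
pose P0 : mpoly.mpoly n R := \sum_i v i *: mpoly.mpolyX R (mpoly.bmnm (enum_val i)).
have sP0 : polys R n s P0.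
  apply: polys_sum => i; apply: polysZ; apply/polysP.
  by rewrite mpoly.mmeasureX/=; exact: mpoly.bmdeg.
have [P sP PP0] := polys_affine (fun i => - a i / l) (fun=> l^-1) sP0.
exists P => // x; rewrite /peval PP0 raddf_sum/=; apply: eq_bigr => i _.
rewrite mpoly.mevalZ mpoly.mevalX; congr (_ * _); apply: eq_bigr => j _.
by rewrite /rescale; congr (_ ^+ _); ring.
Qed.

End boxes.

(** * Moment projections on a box *)

Section box_projection.
Context (R : realType) (n s : nat) (l : R) (a : 'I_n -> R) (b c : 'I_n -> bool).
Hypothesis l0 : 0 < l.
Let Q := box l a b c.
Let e := @monomial_basis R n l a s.
Let mQ : measurable Q. Proof. exact: measurable_box. Qed.
Let Qoo : (leb Q < +oo)%E. Proof. by rewrite leb_box// ltry. Qed.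
Let Qp : (0 < leb Q)%E. Proof. by rewrite leb_box// lte_fin exprn_gt0. Qed.
Let me i : measurable_fun Q (e i). Proof. exact: measurable_monomial_basis. Qed.
Let e1 i x : Q x -> `|e i x| <= 1. Proof. exact: monomial_basis_le1. Qed.

Lemma measurable_peval_box P : polys R n s P -> measurable_fun Q (peval P).
Proof.
move=> /(peval_comb a l0)[v Pv]; have -> : peval P = comb e v by exact/funext.
exact: measurable_comb.
Qed.

Lemma peval_box_bounded P : polys R n s P ->
  exists M, forall x, Q x -> `|peval P x| <= M.
Proof.
move=> /(peval_comb a l0)[v Pv]; exists (\sum_i `|v i|) => x Qx.
by rewrite Pv (comb_bounded e1).
Qed.

Lemma integrable_mul_peval (g : Rn R n -> R) P : polys R n s P ->
  leb.-integrable Q (EFin \o g) ->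
  leb.-integrable Q (EFin \o (fun x => g x * peval P x)).
Proof.
move=> sP ig; have [M PM] := peval_box_bounded sP.
exact: integrable_mul_bounded ig (measurable_peval_box sP) PM.
Qed.

Lemma integrable_peval P : polys R n s P ->
  leb.-integrable Q (EFin \o peval P).
Proof.
move=> sP.
have := integrable_mul_peval sP (integrable_cst mQ Qoo 1).
by apply: eq_integrable => // x _ /=; rewrite mul1r.
Qed.

Lemma monom_polys (g : mpoly.multinom n) : (mpoly.mdeg g <= s)%N ->
  polys R n s (mpoly.mpolyX R g) /\ peval (mpoly.mpolyX R g) = monom g.
Proof.
move=> gs; split; first by apply/polysP; rewrite mpoly.mmeasureX.
by apply/funext => x; rewrite /peval mpoly.mevalX.
Qed.

(** By linearity, testing against monomials amounts to testing against polynomials. The passage also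
    goes from integrals in the extended reals to real-valued ones. *)
Lemma orthogonal_monomP (h : Rn R n -> R) : leb.-integrable Q (EFin \o h) ->
  (forall g : mpoly.multinom n, (mpoly.mdeg g <= s)%N ->
    (\int[leb]_(x in Q) (h x * monom g x)%:E = 0)%E) <->
  (forall P, polys R n s P -> \int[leb]_(x in Q) (h x * peval P x) = 0).
Proof.
move=> ih; split=> [h0 P sP|h0 g gs]; last first.
  have [sg <-] := monom_polys gs.
  (* A real-valued integral equal to 0 could come from an infinite one, since [fine] sends
     infinities to 0; integrability excludes this. *)
  rewrite -[LHS]fineK; last exact: integrable_fin_num (integrable_mul_peval sg ih).
  by congr EFin; exact: h0.
have iX (d : mpoly.bmultinom n s.+1) :
    leb.-integrable Q (EFin \o (fun x => h x * monom (mpoly.bmnm d) x)).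
  have [sg <-] := monom_polys (mpoly.bmdeg d : _ <= s)%N.
  exact: integrable_mul_peval.
pose w (d : mpoly.bmultinom n s.+1) := mpoly.mcoeff (mpoly.bmnm d) P.
transitivity (\int[leb]_(x in Q)
    (\sum_(d : mpoly.bmultinom n s.+1) w d * (h x * monom (mpoly.bmnm d) x))).
  apply: eq_Rintegral => x _; rewrite /peval (meval_polys _ sP) mulr_sumr.
  by apply: eq_bigr => d _; rewrite mulrCA.
rewrite Rintegral_sum//; last by move=> d; exact: (integrableZl mQ (w d) (iX d)).
apply: big1 => d _; rewrite RintegralZl// /Rintegral h0 ?mulr0//.
exact: (mpoly.bmdeg d).
Qed.

(** Uniqueness of the projection up to null sets. If $P_1$ is the selected polynomial and $D = P_1 -
    P$, then $D = (f-P) - (f-P_1)$ is a difference of two functions orthogonal to $D$, hence $\int_Q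
    D^2 = 0$. *)
Lemma moment_proj_ae (f : Rn R n -> R) P :
  leb.-integrable Q (EFin \o f) -> polys R n s P ->
  (forall P', polys R n s P' ->
    \int[leb]_(x in Q) ((f x - peval P x) * peval P' x) = 0) ->
  ae_eq leb Q (residual s Q f) (fun x => f x - peval P x).
Proof.
move=> iF sP P0.
have ifP P1 : polys R n s P1 -> leb.-integrable Q (EFin \o (fun x => f x - peval P1 x)).
  by move=> sP1; exact: integrableB iF (integrable_peval sP1).
have [P1 [sP1 P10] projE] : exists2 P1 : mpoly.mpoly n R, polys R n s P1 /\
    (forall g : mpoly.multinom n, (mpoly.mdeg g <= s)%N ->
      (\int[leb]_(x in Q) ((f x - peval P1 x) * monom g x)%:E = 0)%E) &
    moment_proj s Q f = P1.
  (* The polynomial [P] shows that the set given to [xget] is nonempty, so its default value is not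
     taken. *)
  exists (moment_proj s Q f) => //; rewrite /moment_proj.
  case: xgetP => [P1 _ //|/(_ P)[]]; split => //.
  by apply/orthogonal_monomP => //; exact: ifP.
have {}P10 := (orthogonal_monomP (ifP _ sP1)).1 P10.
have sD : polys R n s (P1 - P) by apply: polysD => //; exact: polysN.
have pD x : peval (P1 - P) x = (f x - peval P x) - (f x - peval P1 x).
  by rewrite /peval mpoly.mevalB; ring.
have : ae_eq leb Q (peval (P1 - P)) (cst 0).
  apply: (Rintegral_sqr_eq0 mQ (measurable_peval_box sD)).
    exact: integrable_mul_peval (integrable_peval sD).
  transitivity (\int[leb]_(x in Q) ((f x - peval P x) * peval (P1 - P) x -
     (f x - peval P1 x) * peval (P1 - P) x)).
    by apply: eq_Rintegral => x _; rewrite {1}pD mulrBl.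
  rewrite RintegralB//; first by rewrite P0// P10// subr0.
  - exact: integrable_mul_peval (ifP _ sP).
  - exact: integrable_mul_peval (ifP _ sP1).
apply: filterS => x + Qx => /(_ Qx); rewrite pD /= /residual projE.
by move/eqP; rewrite subr_eq0 => /eqP.
Qed.

(* The inner matrix is the Gram matrix of [gram_monomial_basis]. *)
Definition gram_const : R :=
  #|{: mpoly.bmultinom n s.+1}|%:R * \sum_i \sum_j
  `|pinvmx (\matrix_(i, j) \prod_(k < n)
     (mpoly.bmnm (enum_val i) k + mpoly.bmnm (enum_val j) k).+1%:R^-1 :
     'M[R]_#|{: mpoly.bmultinom n s.+1}|) i j|.

(** The rescaled monomials are bounded by 1 on the cube, so the supremum of $|P|$ is at most the sum
    of its coefficients in absolute value. Each of these is bounded by [gram_projection], and their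
    number is the first factor of [gram_const]. *)
Lemma box_projection (g : Rn R n -> R) : leb.-integrable Q (EFin \o g) ->
  exists P, [/\ polys R n s P,
    forall P', polys R n s P' ->
      \int[leb]_(x in Q) ((g x - peval P x) * peval P' x) = 0 &
    forall x, Q x ->
      `|peval P x| <= gram_const * ((vol Q)^-1 * \int[leb]_(x in Q) `|g x|)].
Proof.
move=> ig; have [v [v0 vle]] := gram_projection mQ Qoo me e1 Qp ig.
have [P sP Pv] := comb_peval l a v; exists P; split => // [P' sP'|x Qx].
  have [v' P'v'] := peval_comb a l0 sP'.
  transitivity (\int[leb]_(x in Q) ((g x - comb e v x) * comb e v' x)).
    by apply: eq_Rintegral => x _; rewrite Pv P'v'.
  rewrite (Rintegral_mul_comb mQ me e1).
    by apply: big1 => i _; rewrite v0 mulr0.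
  exact: integrableB ig (integrable_comb mQ Qoo me e1 v).
rewrite Pv; apply: le_trans (comb_bounded e1 _ Qx) _.
apply: le_trans (ler_sum _ (fun i _ => vle i)) _.
rewrite sumr_const card_ord /gram_const -/(vol Q) gram_monomial_basis//.
by rewrite -mulrA mulr_natl.
Qed.

(** If $P$ is the projection of $g = f + m$, then $P - m$ satisfies the moment conditions for $f$
    and $f - (P - m) = g - P$. The bound on $P$ then only involves the average of $|g|$. *)
Lemma residual_ae_le (f : Rn R n -> R) m :
  leb.-integrable Q (EFin \o f) -> polys R n s m ->
  {ae leb, forall x, Q x -> `|residual s Q f x| <= `|f x + peval m x| +
    gram_const * ((vol Q)^-1 * \int[leb]_(x in Q) `|f x + peval m x|)}.
Proof.
move=> iF sm; set g := fun x => f x + peval m x.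
have ig : leb.-integrable Q (EFin \o g) by exact: integrableD iF (integrable_peval sm).
have [P [sP P0 Ple]] := box_projection ig.
have sPm : polys R n s (P - m) by apply: polysD => //; exact: polysN.
have pE x : f x - peval (P - m) x = g x - peval P x.
  by rewrite /g /peval mpoly.mevalB; ring.
have : ae_eq leb Q (residual s Q f) (fun x => f x - peval (P - m) x).
  apply: moment_proj_ae => // P' sP'; rewrite -[RHS](P0 P' sP').
  by apply: eq_Rintegral => x _; rewrite pE.
apply: filterS => x + Qx => /(_ Qx) ->; rewrite pE.
by apply: le_trans (ler_normB _ _) _; rewrite lerD2l Ple.
Qed.

End box_projection.

(** * Powers of averages *)

(** Compare $x + y$ with twice the maximum, whose power is one of the two summands. *)
Lemma powR_add_le (R : realType) (x y q : R) : 0 <= x -> 0 <= y -> 0 <= q ->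
  (x + y) `^ q <= 2 `^ q * (x `^ q + y `^ q).
Proof.
move=> x0 y0 q0; pose z := Num.max x y.
have z0 : 0 <= z by rewrite le_max x0.
have xz : x <= z by rewrite le_max lexx.
have yz : y <= z by rewrite le_max lexx orbT.
apply: (@le_trans _ _ ((2 * z) `^ q)).
  by apply: ge0_ler_powR => //; rewrite ?nnegrE; lra.
rewrite powRM// ler_wpM2l ?powR_ge0// /z maxEle.
by case: ifP => _; rewrite ?lerDl ?lerDr powR_ge0.
Qed.

Lemma le_add1_powR (R : realType) (x q : R) : 0 <= x -> 1 <= q ->
  x <= 1 + x `^ q.
Proof.
move=> x0 q1; have [x1|x1] := leP x 1.
  by rewrite (le_trans x1)// lerDl powR_ge0.
by rewrite -{1}(powRr1 x0) ler_wpDl// ler_powR// ltW.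
Qed.

Lemma powR_le_add1 (R : realType) (x r : R) : 0 <= x -> 0 <= r <= 1 ->
  x `^ r <= 1 + x.
Proof.
move=> x0 /andP[r0 r1]; have [x1|x1] := leP x 1.
  rewrite (@le_trans _ _ 1) ?lerDl//.
  rewrite (_ : 1 = 1 `^ r); last by rewrite powR1.
  by rewrite ge0_ler_powR// nnegrE.
by rewrite -[in leRHS](powRr1 x0) ler_wpDl// ler_powR// ltW.
Qed.

Section power_integrals.
Context (d : measure_display) (T : measurableType d) (R : realType)
  (mu : {measure set T -> \bar R}) (D : set T) (q : R).
Hypotheses (mD : measurable D) (muD : (mu D < +oo)%E) (q1 : 1 <= q).

Let qp : 0 < q. Proof. exact: lt_le_trans q1. Qed.

Let q0 : 0 <= q. Proof. exact: le_trans q1. Qed.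

Lemma measurable_norm_powR (f : T -> R) : measurable_fun D f ->
  measurable_fun D (fun x => `|f x| `^ q).
Proof.
move=> mf; apply: (measurableT_comp (measurable_powR q)).
exact: measurableT_comp.
Qed.

Lemma integrable_norm_powR (f : T -> R) : measurable_fun D f ->
  (\int[mu]_(x in D) (`|f x| `^ q)%:E < +oo)%E ->
  mu.-integrable D (EFin \o (fun x => `|f x| `^ q)).
Proof.
move=> mf foo; apply/integrableP; split.
  exact/measurable_EFinP/measurable_norm_powR.
by under eq_integral do rewrite /= ger0_norm ?powR_ge0//.
Qed.

Lemma integrable_of_powR (f : T -> R) : measurable_fun D f ->
  mu.-integrable D (EFin \o (fun x => `|f x| `^ q)) ->
  mu.-integrable D (EFin \o f).
Proof.
move=> mf ifq.
apply: (le_integrable mD _ _ (integrableD mD (integrable_cst mD muD 1) ifq)).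
  exact/measurable_EFinP.
move=> x Dx /=; rewrite lee_fin [leRHS]ger0_norm ?addr_ge0 ?powR_ge0//.
exact: le_add1_powR.
Qed.

Lemma integrable_powR_add (f g : T -> R) : measurable_fun D f ->
  measurable_fun D g ->
  mu.-integrable D (EFin \o (fun x => `|f x| `^ q)) ->
  mu.-integrable D (EFin \o (fun x => `|g x| `^ q)) ->
  mu.-integrable D (EFin \o (fun x => `|f x + g x| `^ q)).
Proof.
move=> mf mg ifq igq.
apply: (le_integrable mD _ _ (integrableZl mD (2 `^ q) (integrableD mD ifq igq))).
  by apply/measurable_EFinP/measurable_norm_powR; exact: measurable_funD.
move=> x Dx /=; rewrite lee_fin [leLHS]ger0_norm ?powR_ge0//.
rewrite [leRHS]ger0_norm ?mulr_ge0 ?addr_ge0 ?powR_ge0//.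
apply: (@le_trans _ _ ((`|f x| + `|g x|) `^ q)); last exact: powR_add_le.
by apply: ge0_ler_powR; rewrite ?nnegrE ?addr_ge0// ler_normD.
Qed.

Lemma integrable_powR_bounded (f : T -> R) (M : R) : measurable_fun D f ->
  (forall x, D x -> `|f x| <= M) ->
  mu.-integrable D (EFin \o (fun x => `|f x| `^ q)).
Proof.
move=> mf fM; apply: (le_integrable mD _ _ (integrable_cst mD muD (M `^ q))).
  exact/measurable_EFinP/measurable_norm_powR.
move=> x Dx /=; rewrite lee_fin [leLHS]ger0_norm ?[leRHS]ger0_norm ?powR_ge0//.
have fxM := fM x Dx.
by apply: ge0_ler_powR; rewrite ?nnegrE// (le_trans _ fxM).
Qed.

(** A weak form of Hoelder's inequality. Integrating $t \le 1 + t^q$ at $t = |f|/\varepsilon$ bounds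
    the average of $|f|$ by $\varepsilon + \varepsilon^{1-q} A$, where $A$ is the average of
    $|f|^q$, and $\varepsilon$ is then chosen. *)
Lemma average_le_powR (f : T -> R) : (0 < mu D)%E -> measurable_fun D f ->
  mu.-integrable D (EFin \o (fun x => `|f x| `^ q)) ->
  (fine (mu D))^-1 * \int[mu]_(x in D) `|f x| <=
  2 * ((fine (mu D))^-1 * \int[mu]_(x in D) (`|f x| `^ q)) `^ q^-1.
Proof.
move=> muD0 mf ifq; set V := fine (mu D); set A := (X in _ * X `^ _).
have V0 : 0 < V by rewrite fine_gt0// muD0 muD.
have A0 : 0 <= A.
  by rewrite mulr_ge0 ?invr_ge0 ?(ltW V0)// Rintegral_ge0// => x _; rewrite powR_ge0.
have iabs : mu.-integrable D (EFin \o (fun x => `|f x|)).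
  exact: integrable_norm (integrable_of_powR mf ifq).
have H eps : 0 < eps -> V^-1 * \int[mu]_(x in D) `|f x| <=
    eps + eps * (eps^-1 `^ q * A).
  move=> e0.
  have ibound : mu.-integrable D (EFin \o (fun x => eps * eps^-1 `^ q * `|f x| `^ q)).
    exact: (integrableZl mD _ ifq).
  have -> : eps + eps * (eps^-1 `^ q * A) =
      V^-1 * \int[mu]_(x in D) (eps + eps * eps^-1 `^ q * `|f x| `^ q).
    rewrite RintegralD//; last exact: integrable_cst.
    rewrite RintegralZl// Rintegral_cst// -/V /A.
    by field; rewrite gt_eqF.
  rewrite ler_pM2l ?invr_gt0//; apply: le_Rintegral => //.
    exact: integrableD (integrable_cst mD muD eps) ibound.
  move=> x Dx; rewrite -mulrA -powRM ?invr_ge0 ?(ltW e0)//.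
  rewrite -[X in _ <= X + _](mulr1 eps) -mulrDr -ler_pdivrMl//.
  by apply: le_add1_powR => //; rewrite mulr_ge0// invr_ge0 ltW.
(* For $A = 0$ the choice made below would not be positive; here $\varepsilon$ is arbitrary and
   tends to 0. *)
have [A00|An0] := eqVneq A 0.
  rewrite A00 powR0 ?mulr0 ?invr_neq0 ?gt_eqF//.
  apply/ler_addgt0Pr => eps e0; rewrite add0r.
  by have := H _ e0; rewrite A00 !mulr0 addr0.
have Ap : 0 < A by rewrite lt_def An0.
(* With $\varepsilon = A^{1/q}$ both terms equal $A^{1/q}$, whence the factor 2. *)
have := H (A `^ q^-1) (powR_gt0 _ Ap).
rewrite -powRN -powRrM mulNr mulVf ?gt_eqF// powR_inv1// mulVf// mulr1.
by move=> /le_trans; apply; lra.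
Qed.

End power_integrals.

Lemma Rintegral_disjoint_le (d : measure_display) (T : measurableType d)
    (R : realType) (mu : {measure set T -> \bar R}) (D : set T)
    (S : seq (set T)) (h : T -> R) :
  measurable D -> uniq S -> trivIset [set` S] id ->
  (forall Q, Q \in S -> measurable Q /\ Q `<=` D) ->
  mu.-integrable D (EFin \o h) -> (forall x, D x -> 0 <= h x) ->
  \sum_(Q <- S) \int[mu]_(x in Q) h x <= \int[mu]_(x in D) h x.
Proof.
move=> mD uS tS SD ih h0.
(* Additivity over a finite union is stated for families measurable at every index, so sets outside
   [S] are replaced by the empty set. *)
pose F (Q : set T) : set T := if Q \in S then Q else set0.
have mF Q : measurable (F Q) by rewrite /F; case: ifPn => // /SD[].
have FD : \big[setU/set0]_(Q <- S) F Q `<=` D.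
  rewrite -bigcup_seq => x [Q /= QS]; rewrite /F QS.
  by have [_] := SD _ QS; apply.
have mU : measurable (\big[setU/set0]_(Q <- S) F Q) by apply: bigsetU_measurable.
have mh : measurable_fun D (EFin \o h) by exact: measurable_int ih.
have tF : trivIset [set` S] F.
  move=> Q1 Q2 /= S1 S2; rewrite /F S1 S2; exact: tS.
rewrite -lee_fin -sumEFin big_seq.
rewrite (eq_bigr (fun Q => \int[mu]_(x in F Q) (h x)%:E)%E); last first.
  move=> Q QS; have [mQ QD] := SD _ QS; rewrite /F QS /Rintegral fineK//.
  by apply: integrable_fin_num => //; exact: integrableS ih.
rewrite -big_seq /Rintegral fineK; last exact: integrable_fin_num.
rewrite -(@ge0_integral_bigsetU _ _ _ mu _ F (EFin \o h) S)//.
- by apply: ge0_subset_integral => // x /h0; rewrite lee_fin.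
- exact: measurable_funS mh.
- by move=> x /FD /h0; rewrite lee_fin.
Qed.

(** True for every [f] and [Q]: where no polynomial meets the moment conditions, [xget] returns 0,
    which has admissible degree. *)
Lemma moment_proj_polys (R : realType) (n s : nat) (Q : set (Rn R n))
    (f : Rn R n -> R) : polys R n s (moment_proj s Q f).
Proof. by rewrite /moment_proj; case: xgetP => [P _ []//|_]; exact: polys0. Qed.

(** Apply $t^r \le 1 + t$ to $t = (I/V)/A$. With $A$ fixed as the average over the large cube, the
    right-hand side is additive in $V$ and $I$, so it can be summed over disjoint cubes. *)
Lemma powR_average_le (R : realType) (V I A r : R) : 0 < V -> 0 <= I -> 0 <= A ->
  (A = 0 -> I = 0) -> 0 < r <= 1 ->
  V * (V^-1 * I) `^ r <= A `^ r * (V + I / A).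
Proof.
move=> V0 I0 A0 AI /andP[r0 r1]; have [A00|An0] := eqVneq A 0.
  by rewrite (AI A00) mulr0 powR0 ?gt_eqF// mulr0 mulr_ge0 ?powR_ge0// mul0r addr0 ltW.
have Ap : 0 < A by rewrite lt_def An0.
have VI0 : 0 <= V^-1 * I / A by rewrite !mulr_ge0// invr_ge0 ltW.
rewrite -[in leLHS](divfK An0 (V^-1 * I)) powRM// (mulrC (_ `^ r)) mulrCA.
rewrite ler_wpM2l ?powR_ge0//.
apply: (@le_trans _ _ (V * (1 + V^-1 * I / A))).
  by rewrite ler_pM2l// powR_le_add1// (ltW r0).
by rewrite mulrDr mulr1 !mulrA mulfV ?gt_eqF// mul1r.
Qed.

(** * Upper bound for the John-Nirenberg-Campanato norm *)

Section JN_upper_bound.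
Context (R : realType) (n s : nat) (p q : R).
Hypotheses (p1 : 1 < p) (pq : p <= q).
Let q1 : 1 <= q. Proof. by rewrite (le_trans _ pq)// ltW. Qed.
Let p0 : 0 < p. Proof. exact: lt_trans p1. Qed.
Let q0 : 0 < q. Proof. exact: lt_le_trans pq. Qed.

(** The factor $2^q$ comes from [powR_add_le], and the 2 next to [gram_const] from
    [average_le_powR]. *)
Definition residual_const : R := 2 `^ q * (1 + (2 * gram_const R n s) `^ q).

Lemma gram_const_ge0 : 0 <= gram_const R n s.
Proof.
by rewrite mulr_ge0// sumr_ge0// => i _; rewrite sumr_ge0.
Qed.

Lemma residual_const_gt0 : 0 < residual_const.
Proof. by rewrite mulr_gt0 ?powR_gt0// ltr_wpDr ?powR_ge0. Qed.

(** Raise [residual_ae_le] to the power $q$ and integrate. The averaged term is a constant, at most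
    $2K A^{1/q}$ with $A$ the average of $|g|^q$, so its power is at most $(2K)^q A$. *)
Lemma residual_power_le (l : R) (a : 'I_n -> R) (b c : 'I_n -> bool)
    (f : Rn R n -> R) (m : mpoly.mpoly n R) :
  0 < l -> polys R n s m -> leb.-integrable (box l a b c) (EFin \o f) ->
  leb.-integrable (box l a b c)
    (EFin \o (fun x => `|f x + peval m x| `^ q)) ->
  (\int[leb]_(x in box l a b c) (`|residual s (box l a b c) f x| `^ q)%:E <=
   (residual_const *
     \int[leb]_(x in box l a b c) (`|f x + peval m x| `^ q))%:E)%E.
Proof.
move=> l0 sm; set Q := box l a b c => iF igq; set g := fun x => f x + peval m x.
have mQ : measurable Q by exact: measurable_box.
have Qoo : (leb Q < +oo)%E by rewrite leb_box// ltry.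
have Qp : (0 < leb Q)%E by rewrite leb_box// lte_fin exprn_gt0.
have V0 : 0 < vol Q by rewrite vol_box// exprn_gt0.
have mf : measurable_fun Q f by apply/measurable_EFinP; exact: measurable_int iF.
have mg : measurable_fun Q g by apply: measurable_funD => //; exact: measurable_peval_box sm.
have avg := average_le_powR mQ Qoo q1 Qp mg igq.
set A := (X in _ <= _ * X `^ _) in avg.
have A0 : 0 <= A.
  by rewrite mulr_ge0 ?invr_ge0 ?(ltW V0)// Rintegral_ge0// => x _; rewrite powR_ge0.
set K := gram_const R n s.
have ibound : leb.-integrable Q
    (EFin \o (fun x => 2 `^ q * (`|g x| `^ q + (2 * K) `^ q * A))).
  exact: (integrableZl mQ _ (integrableD mQ igq (integrable_cst mQ Qoo _))).
(* The bound is rewritten as the integral of a pointwise majorant. This uses that $|Q| A$ is the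
   integral of $|g|^q$ over $Q$. *)
have -> : residual_const * \int[leb]_(x in Q) (`|g x| `^ q) =
    \int[leb]_(x in Q) (2 `^ q * (`|g x| `^ q + (2 * K) `^ q * A)).
  rewrite RintegralZl//; last exact: integrableD igq (integrable_cst mQ Qoo _).
  rewrite RintegralD//; last exact: integrable_cst.
  rewrite Rintegral_cst// /residual_const /A -/K -/(vol Q).
  by field; rewrite gt_eqF.
rewrite /Rintegral fineK; last exact: integrable_fin_num.
apply: ae_ge0_le_integral.
- exact: mQ.
- by move=> x _; rewrite lee_fin powR_ge0.
- apply/measurable_EFinP/measurable_norm_powR; apply: measurable_funB => //.
  exact: measurable_peval_box (moment_proj_polys _ _ _).
- move=> x _; rewrite lee_fin mulr_ge0 ?powR_ge0// addr_ge0 ?powR_ge0//.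
  by rewrite mulr_ge0 ?powR_ge0.
- exact: measurable_int ibound.
have := residual_ae_le l0 iF sm; apply: filterS => x + Qx => /(_ Qx) resx.
have K0 : 0 <= K := gram_const_ge0.
rewrite lee_fin.
apply: (@le_trans _ _ ((`|g x| + 2 * K * A `^ q^-1) `^ q)).
  apply: ge0_ler_powR; rewrite ?nnegrE ?(ltW q0)//.
    by rewrite addr_ge0// mulr_ge0 ?powR_ge0// mulr_ge0.
  apply: le_trans resx _; rewrite lerD2l -/Q.
  apply: le_trans (ler_wpM2l K0 avg) _.
  by rewrite mulrCA mulrA.
apply: le_trans (powR_add_le _ _ (ltW q0)) _ => //.
  by rewrite mulr_ge0 ?powR_ge0// mulr_ge0.
have K20 : 0 <= 2 * K by rewrite mulr_ge0.
by rewrite (powRM _ K20) ?powR_ge0// -powRrM mulVf ?gt_eqF// powRr1.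
Qed.

(** With $r = p/q$, each cube contributes at most $L^r A^r (|Q| + I_Q/A)$, where $L$ is
    [residual_const], $I_Q$ the integral of $|g|^q$ over $Q$ and $A$ its average over $Q_0$. The
    volumes and the $I_Q/A$ each sum to at most $|Q_0|$, which produces the factor 2. *)
Lemma JN_norm_le (l : R) (a : 'I_n -> R) (b c : 'I_n -> bool)
    (f : Rn R n -> R) (m : mpoly.mpoly n R) :
  let Q0 := box l a b c in
  0 < l -> polys R n s m -> leb.-integrable Q0 (EFin \o f) ->
  leb.-integrable Q0 (EFin \o (fun x => `|f x + peval m x| `^ q)) ->
  (JN_norm p q s 0 Q0 f <= ((2 * residual_const `^ (p / q)) `^ p^-1)%:E *
     ((vol Q0 `^ p^-1)%:E * avg_norm q Q0 (fun x => f x + peval m x)%R))%E.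
Proof.
move=> Q0 l0 sm iF igq; set g := fun x => f x + peval m x.
set h := fun x => `|g x| `^ q.
have h0 x : 0 <= h x by exact: powR_ge0.
have mQ0 : measurable Q0 by exact: measurable_box.
have Q0oo : (leb Q0 < +oo)%E by rewrite leb_box// ltry.
have V0 : 0 < vol Q0 by rewrite vol_box// exprn_gt0.
have Lp := residual_const_gt0.
set r := p / q.
have r01 : 0 < r <= 1 by rewrite divr_gt0//= ler_pdivrMr// mul1r.
pose I0 := \int[leb]_(x in Q0) h x.
pose A := (vol Q0)^-1 * I0.
have I0_ge0 : 0 <= I0 by exact: Rintegral_ge0.
have A0 : 0 <= A by rewrite mulr_ge0 ?invr_ge0 ?(ltW V0).
have -> : avg_norm q Q0 g = (A `^ q^-1)%:E.
  rewrite /avg_norm -poweR_EFin /A EFinM /I0 /Rintegral fineK//.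
  exact: integrable_fin_num.
(* Everything is put under the power $1/p$, using $r/p = 1/q$, so that the comparison takes place
   before the root. *)
have -> : (((2 * residual_const `^ r) `^ p^-1)%:E *
    ((vol Q0 `^ p^-1)%:E * (A `^ q^-1)%:E) =
    ((2 * residual_const `^ r * (vol Q0 * A `^ r))%:E) `^ p^-1)%E.
  rewrite poweR_EFin -!EFinM; congr EFin.
  have : 0 <= 2 * residual_const `^ r by rewrite mulr_ge0 ?powR_ge0.
  move: (2 * _ `^ r) => u u0.
  rewrite [in RHS]powRM ?mulr_ge0 ?powR_ge0 ?(ltW V0)//.
  rewrite [in RHS]powRM ?powR_ge0 ?(ltW V0)// -[in RHS]powRrM.
  have -> // : r * p^-1 = q^-1.
  by rewrite /r mulrAC mulfV ?gt_eqF// mul1r.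
rewrite /JN_norm; apply: gt0_ler_poweR.
- by rewrite invr_ge0 ltW.
- rewrite in_itv/= leey andbT; apply: ereal_sup_ubound.
  (* The empty family contributes 0, so the supremum is nonnegative, as monotonicity of the power
     requires. *)
  by exists set0; [split=> [? []|? ? []]|rewrite esum_set0].
- by rewrite in_itv/= leey andbT lee_fin !mulr_ge0 ?powR_ge0 ?(ltW V0).
apply: ge_ereal_sup => _ [C [CQ tC] <-].
(* [\esum] is itself a supremum of finite sums, which leaves a finite subfamily [F] of [C]. *)
apply: ge_ereal_sup => _ [F [finF FC] <-].
rewrite fsbig_finite//; set S := finmap.enum_fset _.
have SF Q : Q \in S -> F Q by rewrite in_fset_set// inE.
have Sbox Q : Q \in S -> exists l' a' b' c', [/\ 0 < l', Q = box l' a' b' c' & Q `<=` Q0].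
  move=> /SF /FC /CQ [[l' [a' [b' [c' [l'0 ->]]]]] QQ0].
  by exists l', a', b', c'; split.
have SD Q : Q \in S -> measurable Q /\ Q `<=` Q0.
  by move=> /Sbox[l' [a' [b' [c' [l'0 -> QQ0]]]]]; split => //; exact: measurable_box.
have uS : uniq S by exact: finmap.fset_uniq.
have tS : trivIset [set` S] id.
  by apply: sub_trivIset tC => Q /= /SF /FC.
pose T Q := residual_const `^ r * (A `^ r * (vol Q + \int[leb]_(x in Q) h x / A)).
apply: (@le_trans _ _ (\sum_(Q <- S) (T Q)%:E)%E); last first.
  rewrite sumEFin lee_fin -!mulr_sumr big_split/= -mulr_suml.
  have sV : \sum_(Q <- S) vol Q <= vol Q0.
    have := Rintegral_disjoint_le mQ0 uS tS SD (integrable_cst mQ0 Q0oo 1) (fun _ _ => ler01).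
    rewrite Rintegral_cst// mul1r; apply: le_trans.
    rewrite big_seq [leRHS]big_seq; apply: ler_sum => Q /SD[mQ _].
    by rewrite Rintegral_cst// mul1r.
  have sI : \sum_(Q <- S) \int[leb]_(x in Q) h x <= I0.
    exact: Rintegral_disjoint_le.
  (* This is an equality unless $A = 0$, where division by zero gives 0. *)
  have IA : I0 / A <= vol Q0.
    have [->|An0] := eqVneq A 0; first by rewrite invr0 mulr0 ltW.
    by rewrite ler_pdivrMr ?lt_def ?An0// /A mulVKf// gt_eqF.
  have -> : 2 * residual_const `^ r * (vol Q0 * A `^ r) =
    residual_const `^ r * (A `^ r * (vol Q0 + vol Q0)) by ring.
  rewrite !ler_wpM2l ?powR_ge0// lerD// (le_trans _ IA)// ler_wpM2r// invr_ge0//.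
rewrite big_seq [leRHS]big_seq; apply: lee_sum => Q QS.
have [l' [a' [b' [c' [l'0 QE QQ0]]]]] := Sbox _ QS.
have mQ : measurable Q by have [] := SD _ QS.
have VQ : 0 < vol Q by rewrite QE vol_box// exprn_gt0.
have ifQ : leb.-integrable Q (EFin \o f) by exact: integrableS iF.
have ihQ : leb.-integrable Q (EFin \o h) by exact: integrableS igq.
have res : (\int[leb]_(x in Q) (`|residual s Q f x| `^ q)%:E <=
    (residual_const * \int[leb]_(x in Q) h x)%:E)%E.
  by rewrite QE in ifQ ihQ *; exact: residual_power_le.
have I_ge0 : 0 <= \int[leb]_(x in Q) h x by exact: Rintegral_ge0.
apply: (@le_trans _ _ ((vol Q * (residual_const * ((vol Q)^-1 * \int[leb]_(x in Q) h x)) `^ r)%:E)).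
  (* The weight $|Q|^{-\alpha}$ is 1 as $\alpha = 0$, and the exponents $1/q$ and $p$ combine into
     $r$. *)
  rewrite oppr0 powRr0 mul1e EFinM lee_pmul2l// -poweR_EFin.
  rewrite /avg_norm -poweRrM /r mulrC.
  apply: gt0_ler_poweR.
  - by rewrite divr_ge0 ?ltW.
  - rewrite in_itv/= leey andbT mule_ge0 ?lee_fin ?invr_ge0 ?(ltW VQ)//.
    by apply: integral_ge0 => x _; rewrite lee_fin powR_ge0.
  - by rewrite in_itv/= leey andbT lee_fin mulr_ge0 ?(ltW Lp)//
      mulr_ge0 ?invr_ge0 ?(ltW VQ).
  - by rewrite mulrCA EFinM lee_pmul2l// lte_fin invr_gt0.
rewrite lee_fin powRM ?(ltW Lp)//; last by rewrite mulr_ge0// invr_ge0 ltW.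
rewrite mulrCA /T ler_wpM2l ?powR_ge0//; apply: powR_average_le => //.
(* The degenerate case: if the integral over $Q_0$ vanishes, so does the one over $Q$, by the
   disjoint-family inequality for the family [[:: Q]]. *)
move=> A00; have : I0 = 0 by rewrite -(mulVKf (lt0r_neq0 V0) I0) -/A A00 mulr0.
move=> I00; apply/eqP; rewrite eq_le I_ge0 andbT -I00.
have := @Rintegral_disjoint_le _ _ _ leb Q0 [:: Q] h mQ0 isT.
rewrite big_seq1; apply => //.
- by apply: sub_trivIset tS => Q1 /=; rewrite mem_seq1 => /eqP ->.
- by move=> Q1; rewrite mem_seq1 => /eqP ->; split.
Qed.

End JN_upper_bound.

(** * Comparison of the norms *)

(** The family $\{Q\}$ competes in the supremum. The factor $|Q|^{1/p}$, left by the $p$-th root, is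
    the one that the scaling of the space cancels. *)
Lemma avg_norm_residual_le_JN_norm (R : realType) (n s : nat) (p q l : R)
    (a : 'I_n -> R) (b c : 'I_n -> bool) (f : Rn R n -> R) :
  0 < l -> 0 < p ->
  ((vol (box l a b c) `^ p^-1)%:E *
     avg_norm q (box l a b c) (residual s (box l a b c) f) <=
   JN_norm p q s 0 (box l a b c) f)%E.
Proof.
move=> l0 p0; set Q := box l a b c; set N := avg_norm _ _ _.
have V0 : 0 <= vol Q by rewrite vol_box// exprn_ge0 ?ltW.
have N0 : (0 <= N)%E by exact: poweR_ge0.
have -> : ((vol Q `^ p^-1)%:E * N = ((vol Q)%:E * N `^ p) `^ p^-1)%E.
  by rewrite poweRM ?poweR_ge0// -poweRrM mulfV ?gt_eqF// poweRe1// poweR_EFin.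
have VN0 : (0 <= (vol Q)%:E * N `^ p)%E by rewrite mule_ge0 ?poweR_ge0.
have H : ((vol Q)%:E * N `^ p <= ereal_sup
    [set \esum_(Q' in C) ((vol Q')%:E *
        ((powR (vol Q') (- 0))%:E * avg_norm q Q' (residual s Q' f)) `^ p)
    | C in disjoint_cubes Q])%E.
  apply: ereal_sup_ubound; exists [set Q].
    split=> [_ ->|_ _ -> ->//]; split => //.
    by exists l, a, b, c.
  rewrite esum_set1; first by rewrite oppr0 powRr0 mul1e.
  by rewrite mule_ge0 ?poweR_ge0.
apply: gt0_ler_poweR => //; first by rewrite invr_ge0 ltW.
  by rewrite in_itv/= leey andbT.
by rewrite in_itv/= leey andbT (le_trans VN0 H).
Qed.

(** The opposite of the projection polynomial is one of the competitors in the infimum. *)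
Lemma Lq_mod_norm_le_residual (R : realType) (n s : nat) (q : R)
    (Q : set (Rn R n)) (f : Rn R n -> R) :
  (Lq_mod_norm q s Q f <= avg_norm q Q (residual s Q f))%E.
Proof.
apply: ereal_inf_lbound; exists (- moment_proj s Q f).
  exact/polysN/moment_proj_polys.
congr avg_norm; apply/funext => x.
by rewrite /residual /peval mpoly.mevalN.
Qed.

Lemma avg_norm_lty (R : realType) (n : nat) (q : R) (Q : set (Rn R n))
    (f : Rn R n -> R) : 0 < vol Q -> 0 < q ->
  (avg_norm q Q f < +oo)%E <->
  (\int[leb]_(x in Q) (`|f x| `^ q)%:E < +oo)%E.
Proof.
move=> V0 q0; split => [|foo].
  move=> /lty_poweRy; rewrite invr_eq0 gt_eqF// => /(_ isT).
  move: (\int[leb]_(_ in _) _)%E => [r _|//|//]; first by rewrite ltry.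
  by rewrite gt0_muley// lte_fin invr_gt0.
apply: poweR_lty; rewrite lte_mul_pinfty//.
by rewrite lee_fin invr_ge0 ltW.
Qed.

(** * Equality of the two spaces and equivalence of their norms on a cube *)

Section equivalence.
Context (R : realType) (n s : nat) (p q l : R) (a : 'I_n -> R)
  (b c : 'I_n -> bool).
Hypotheses (p1 : 1 < p) (pq : p <= q) (l0 : 0 < l).
Let Q := box l a b c.
Let p0 : 0 < p. Proof. exact: lt_trans p1. Qed.
Let q1 : 1 <= q. Proof. by rewrite (le_trans _ pq)// ltW. Qed.
Let q0 : 0 < q. Proof. exact: lt_le_trans pq. Qed.
Let mQ : measurable Q. Proof. exact: measurable_box. Qed.
Let Qoo : (leb Q < +oo)%E. Proof. by rewrite leb_box// ltry. Qed.
Let V0 : 0 < vol Q. Proof. by rewrite vol_box// exprn_gt0. Qed.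

Lemma Lq_box_integrable (f : Rn R n -> R) :
  Lq q Q f -> leb.-integrable Q (EFin \o f).
Proof.
move=> [mf foo].
exact: (integrable_of_powR mQ Qoo q1 mf (integrable_norm_powR mf foo)).
Qed.

Lemma Lq_add_peval (f : Rn R n -> R) (m : mpoly.mpoly n R) :
  Lq q Q f -> polys R n s m -> Lq q Q (fun x => f x + peval m x).
Proof.
move=> [mf foo] sm; have mm : measurable_fun Q (peval m) := measurable_peval_box l0 sm.
have [M mM] : exists M, forall x, Q x -> `|peval m x| <= M.
  exact: peval_box_bounded sm.
split; first exact: measurable_funD.
have /integrableP[_] := integrable_powR_add mQ q1 mf mm
  (integrable_norm_powR mf foo) (integrable_powR_bounded mQ Qoo q1 mm mM).
by under eq_integral do rewrite /= ger0_norm ?powR_ge0//.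
Qed.

Lemma Lq_scale (k : R) (f : Rn R n -> R) :
  Lq q Q f -> Lq q Q (fun x => k * f x).
Proof.
move=> [mf foo]; split; first exact: measurable_funM.
under eq_integral do rewrite normrM powRM// EFinM.
rewrite ge0_integralZl_EFin; first by rewrite lte_mul_pinfty// lee_fin powR_ge0.
all: first [exact: mQ | exact: powR_ge0 | by move=> x _; rewrite lee_fin powR_ge0
  | exact/measurable_EFinP/measurable_norm_powR].
Qed.

Lemma JN_norm_le_Lq (f : Rn R n -> R) (m : mpoly.mpoly n R) :
  Lq q Q f -> polys R n s m ->
  (JN_norm p q s 0 Q f <=
    ((2 * residual_const n s q `^ (p / q)) `^ p^-1)%:E *
    ((vol Q `^ p^-1)%:E * avg_norm q Q (fun x => f x + peval m x)%R))%E.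
Proof.
move=> Lf sm; have [mg goo] := Lq_add_peval Lf sm.
apply: JN_norm_le => //; first exact: Lq_box_integrable.
exact: integrable_norm_powR.
Qed.

(** Finiteness of the quotient norm is automatic: take $m = 0$ in the infimum. *)
Lemma Lq_modP (f : Rn R n -> R) : carrier (Lq_mod q s Q) f <-> Lq q Q f.
Proof.
split=> [[]//|Lf]; split=> //; have [_ foo] := Lq_add_peval Lf (@polys0 R n s).
apply: (@le_lt_trans _ _ (avg_norm q Q (fun x => f x + peval 0 x))).
  by apply: ereal_inf_lbound; exists 0 => //; exact: polys0.
exact/avg_norm_lty.
Qed.

(** A finite norm puts the residual in $L^q$, and adding back the projection polynomial, bounded on
    the cube, recovers $f$. The converse is the upper bound with $m = 0$. *)
Lemma JN_Lq (f : Rn R n -> R) : carrier (JN p q s 0 Q) f <-> Lq q Q f.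
Proof.
split=> [[[mf _] foo]|Lf].
  split=> //; have sP := moment_proj_polys s Q f.
  have mP : measurable_fun Q (peval (moment_proj s Q f)) := measurable_peval_box l0 sP.
  have mr : measurable_fun Q (residual s Q f) by exact: measurable_funB.
  have Lr : Lq q Q (residual s Q f).
    split => //; apply/(avg_norm_lty _ V0 q0).
    (* Since $|Q|^{1/p} > 0$, an infinite average for the residual would force an infinite norm. *)
    rewrite ltey; apply/eqP => Noo.
    have := avg_norm_residual_le_JN_norm s q a b c f l0 p0.
    rewrite Noo gt0_muley ?lte_fin ?powR_gt0// leye_eq => /eqP Joo.
    by move: foo; rewrite /= Joo.
  have [_] := Lq_add_peval Lr sP.
  by under eq_integral => x _ do rewrite /residual subrK.
have iF := Lq_box_integrable Lf.
split; first split; first by case: Lf.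
  move=> E mE _ _; apply: (integrable_mul_bounded mQ iF (M := 1)).
    exact: measurable_indic.
  by move=> x _; rewrite indicE; case: (_ \in _); rewrite ?normr1 ?normr0.
apply: le_lt_trans (JN_norm_le_Lq Lf (@polys0 R n s)) _.
have [_ foo] := Lq_add_peval Lf (@polys0 R n s).
rewrite lte_mul_pinfty ?lee_fin ?powR_ge0//.
by rewrite lte_mul_pinfty ?lee_fin ?powR_ge0//; exact/avg_norm_lty.
Qed.

Lemma JN_Lq_mod_box :
  eq_equiv_norms (scale_space (vol Q `^ (- p^-1)) (JN p q s 0 Q)) (Lq_mod q s Q).
Proof.
set A := vol Q `^ (- p^-1).
have A0 : 0 < A by rewrite powR_gt0.
have carr f : carrier (scale_space A (JN p q s 0 Q)) f <-> Lq q Q f.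
  split=> [[f' /JN_Lq Lf' <-]|Lf]; first exact: Lq_scale.
  exists (fun x => A^-1 * f x); first exact/JN_Lq/Lq_scale.
  by apply/funext => x; rewrite mulVKf// gt_eqF.
split; first by apply/seteqP; split=> f => [/carr/Lq_modP|/Lq_modP/carr].
have AV : A * vol Q `^ p^-1 = 1 by rewrite /A powRN mulVf// gt_eqF// powR_gt0.
set C := (2 * residual_const n s q `^ (p / q)) `^ p^-1.
have C0 : 0 < C by rewrite powR_gt0// mulr_gt0// powR_gt0// residual_const_gt0.
(* The lower constant is 1 because $|Q|^{-1/p}$ cancels $|Q|^{1/p}$ exactly; [C] is the constant of
   [JN_norm_le_Lq], which is independent of the cube. *)
exists 1, C; split=> // f /carr Lf /=; split.
  rewrite mul1e; apply: le_trans (Lq_mod_norm_le_residual _ _ _ _) _.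
  rewrite -[leLHS]mul1e -AV EFinM -muleA lee_pmul2l//.
  exact: avg_norm_residual_le_JN_norm.
(* Moving [C] inside the infimum reduces the claim to one polynomial $m$ at a time. *)
rewrite -ereal_inf_pZl//; apply: le_ereal_inf_tmp => _ [_ [m sm <-] <-].
apply: (@le_trans _ _ (A%:E * (C%:E * ((vol Q `^ p^-1)%:E *
    avg_norm q Q (fun x => f x + peval m x)%R)))%E).
  by rewrite lee_pmul2l//; exact: JN_norm_le_Lq.
by rewrite muleCA lee_pmul2l// muleA -EFinM AV mul1e.
Qed.

End equivalence.

Unset Implicit Arguments.

Theorem proposition1p4 (R : realType) (n : nat) (p q : R) (s : nat)
  (Q0 : set (Rn R n)) (hn : (0 < n)%N) (hp : 1 < p) (hq : p <= q)
  (hQ0 : closed_cube Q0) (hQ0T : Q0 `<` setT) :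
  eq_equiv_norms (scale_space (vol Q0 `^ (- p^-1)) (JN p q s 0 Q0))
                 (Lq_mod q s Q0).
Proof.
have [l [a [l0 ->]]] := hQ0.
(* A left bound [BSide true] and a right bound [BSide false] both include their endpoint, so these
   choices describe the closed cube. *)
exact: (@JN_Lq_mod_box R n s p q l a (fun=> true) (fun=> false)).
Qed.
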